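(* Let $1<q<\infty$ and $q/(q+1)<p<\infty$, and let $r$ be defined by $\frac1p+\frac1r=1+\frac1q$, i.e. $r=\frac{pq}{pq+p-q}$. Then for all $x\in[0,\pi_{p,q}/2)$, $$\sin_{p,q}x=\frac{\sinh_{r,q}x}{\cosh_{r,q}^{r/q}x},\qquad \cos_{p,q}x=\frac{1}{\cosh_{r,q}^{r/p}x}.$$
   Context: For $1<q<\infty$ and $q/(q+1)<p<\infty$ (note that $p\le 1$ is allowed): Let $F_{p,q}(y)=\int_0^y \frac{dt}{(1-t^q)^{1/p}}$ for $y\in[0,1)$ and $\pi_{p,q}=2\int_0^1\frac{dt}{(1-t^q)^{1/p}}\in(0,\infty]$, which is finite for $p>1$ and equals $\infty$ for $p\le 1$. The function $\sin_{p,q}:[0,\pi_{p,q}/2)\to[0,1)$ is the inverse of $F_{p,q}$, and $\cos_{p,q}x=\frac{d}{dx}\sin_{p,q}x$ (one-sided derivative at $x=0$). Let $G_{p,q}(y)=\int_0^y \frac{dt}{(1+t^q)^{1/p}}$ for $y\in[0,\infty)$. With $r=r(p)$ defined by $\frac1p+\frac1r=1+\frac1q$ (so that $r>q/(q+1)$ as well, and $r(r(p))=p$), $\sinh_{p,q}:[0,\pi_{r(p),q}/2)\to[0,\infty)$ is the inverse of $G_{p,q}$ (one has $\lim_{y\to\infty}G_{p,q}(y)=\pi_{r(p),q}/2$), and $\cosh_{p,q}x=\frac{d}{dx}\sinh_{p,q}x$ (one-sided derivative at $x=0$). In particular $\sinh_{r,q}$ and $\cosh_{r,q}$ are defined on $[0,\pi_{p,q}/2)$.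 The notation $\sin_{p,q}^a x$ means $(\sin_{p,q}x)^a$, and similarly for the other functions. *)

(* Defs.v *)
From HB Require Import structures.
From mathcomp Require Import all_boot all_order all_algebra.
From mathcomp Require Import all_classical all_reals all_analysis.
Set Implicit Arguments.
Unset Strict Implicit.
Unset Printing Implicit Defensive.
Import Order.TTheory GRing.Theory Num.Theory.
Import numFieldNormedType.Exports.
Local Open Scope classical_set_scope.
Local Open Scope ring_scope.

Section generalized_trigonometric_functions.
Context {R : realType}.
Implicit Types (p q x y : R) (f : R -> R).

Definition F_pq p q y : R :=
  \int[lebesgue_measure]_(t in `[0, y]) (((1 - t `^ q) `^ p^-1)^-1).

Definition G_pq p q y : R :=
  \int[lebesgue_measure]_(t in `[0, y]) (((1 + t `^ q) `^ p^-1)^-1).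

(* The endpoint 1, where the integrand is singular, is left out: in [R],
   [0^-1 = 0]. The value is [+oo] for [p <= 1]. *)
Definition pi_pq p q : \bar R :=
  (2%:E * \int[lebesgue_measure]_(t in `[0%R, 1%R[)
            (((1 - t `^ q) `^ p^-1)^-1)%:E)%E.

(* [sin_pq p q] is meaningful on [F_pq p q @` `[0, 1[] only, and [sinh_pq p q]
   on [G_pq p q @` `[0, +oo[]; elsewhere they take the junk value 0. *)
Definition sin_pq p q : R -> R := 'pinv_(fun=> 0) `[0, 1[ (F_pq p q).

Definition sinh_pq p q : R -> R := 'pinv_(fun=> 0) `[0, +oo[ (G_pq p q).

(* Derivative of a function on an interval [[0, b[], one-sided at 0. *)
Definition derive1_from0 f x : R :=
  if x == 0 then lim (h^-1 * (f h - f 0) @[h --> 0^'+]) else derive1 f x.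

Definition cos_pq p q : R -> R := derive1_from0 (sin_pq p q).

Definition cosh_pq p q : R -> R := derive1_from0 (sinh_pq p q).

End generalized_trigonometric_functions.

(* Main.v *)
(* The map s |-> s / (1 + s^q)^(1/q) sends [0, +oo[ onto [0, 1[. Substituting it
   in the integral defining F_{p,q} turns F_{p,q} into G_{r,q}, precisely because
   1/p + 1/r = 1 + 1/q. So, at a point x = G_{r,q}(s), sinh_{r,q} x = s and
   sin_{p,q} x = s / (1 + s^q)^(1/q), while cosh_{r,q} x = (1 + s^q)^(1/r) and
   cos_{p,q} x = (1 + s^q)^(-1/p) since the derivative of the inverse of a
   primitive is the inverse of the integrand. *)
Require Import Defs.
From HB Require Import structures.
From mathcomp Require Import all_boot all_order all_algebra.
From mathcomp Require Import all_classical all_reals all_analysis.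
From mathcomp Require Import ring lra.
Import Order.TTheory GRing.Theory Num.Theory.
Import numFieldNormedType.Exports.
Local Open Scope ring_scope.

(** * Primitives of positive continuous functions and their inverses *)

Section primitive.
Local Open Scope classical_set_scope.
Local Open Scope ring_scope.
Context {R : realType}.
Local Notation mu := (@lebesgue_measure R).
(** [D] will be []-oo, 1[] for the sine and the whole line for the hyperbolic sine. Downward closure
    gives integrability on every segment ending in [D]; openness leaves room on the right of each
    point for differentiation. *)
Variables (v : R -> R) (D : set R).
Hypothesis D_down : forall y z, D y -> z <= y -> D z.
Hypothesis D_open : forall y, D y -> exists2 z, y < z & D z.
Hypothesis v_cont : forall y, D y -> {for y, continuous v}.
Hypothesis v_gt0 : forall y, D y -> 0 < v y.

(** Starting the integrals at -1 puts 0 in the interior, so that the primitive is differentiable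
    there on both sides; this is the source of the hypotheses [-1 < y] below. The subtraction
    normalises the value at 0. *)
Definition primitive_at0 y :=
  \int[mu]_(t in `[-1, y]) v t - \int[mu]_(t in `[-1, 0]) v t.

Local Notation V := primitive_at0.

Lemma integrable_segment a y : D y -> mu.-integrable `[a, y] (EFin \o v).
Proof.
move=> Dy; apply: continuous_compact_integrable; first exact: segment_compact.
apply: continuous_in_subspaceT => z; rewrite inE/= in_itv/= => /andP[_ zy].
exact/v_cont/(D_down _ _ Dy).
Qed.

Lemma primitive_at0E y : 0 <= y -> D y -> \int[mu]_(t in `[0, y]) v t = V y.
Proof.
move=> y0 Dy; rewrite /V (@Rintegral_itvB _ _ (BLeft (-1)) (BRight y)) ?bnd_simp//.
- rewrite Rintegral_itv_obnd_cbnd//; apply: integrableS (integrable_segment 0 _ Dy) => //.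
  exact: subset_itv_oc_cc.
- exact: integrable_segment.
Qed.

Lemma primitive_at00 : V 0 = 0.
Proof. by rewrite /V subrr. Qed.

Lemma is_derive_primitive_at0 y : -1 < y -> D y -> is_derive y 1 V (v y).
Proof.
(* The fundamental theorem of calculus is applied on [[-1, z]], where [y] is interior. *)
move=> y1 Dy; have [z yz Dz] := D_open _ Dy.
have [dV V'] := continuous_FTC1_closed yz (integrable_segment (-1) _ Dz) y1
  (v_cont _ Dy).
rewrite derive1E in V'.
rewrite -(subr0 (v y)).
exact: (is_deriveB (DeriveDef dV V') (is_derive_cst _ _ _)).
Qed.

Lemma primitive_at0_continuous y : -1 < y -> D y -> {for y, continuous V}.
Proof.
move=> y1 Dy; apply/differentiable_continuous/derivable1_diffP.
by have [] := is_derive_primitive_at0 _ y1 Dy.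
Qed.

Lemma primitive_at0_lt y z : -1 < y -> y < z -> D z -> V y < V z.
Proof.
move=> y1 yz Dz.
have inD t : t \in `[y, z] -> -1 < t /\ D t.
  rewrite in_itv/= => /andP[yt tz].
  by split; [exact: lt_le_trans yt|exact: D_down _ _ Dz tz].
have dV t : t \in `]y, z[ -> is_derive t 1 V (v t).
  by move=> /subset_itv_oo_cc/inD[t1 Dt]; exact: is_derive_primitive_at0.
apply: (gtr0_derive1_lt_cc (a := y) (b := z)) => //.
- by move=> t /dV[].
- move=> t tyz; have [_] := dV t tyz.
  rewrite derive1E => ->; apply: v_gt0.
  by have /subset_itv_oo_cc/inD[] := tyz.
- apply: continuous_in_subspaceT => t; rewrite inE => /inD[t1 Dt].
  exact: primitive_at0_continuous.
- by rewrite in_itv/= lexx ltW.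
- by rewrite in_itv/= lexx ltW.
Qed.

Lemma primitive_at0_inj y z : -1 < y -> -1 < z -> D y -> D z -> V y = V z -> y = z.
Proof.
move=> y1 z1 Dy Dz Vyz; have [yz|zy|//] := ltgtP y z.
- by have := primitive_at0_lt _ _ y1 yz Dz; rewrite Vyz ltxx.
- by have := primitive_at0_lt _ _ z1 zy Dy; rewrite Vyz ltxx.
Qed.

Lemma primitive_at0_IVT y x : 0 <= y -> D y -> 0 <= x <= V y ->
  exists2 w, w \in `[0, y] & V w = x.
Proof.
move=> y0 Dy /andP[x0 xV]; apply: IVT => //; last first.
  have V0 : 0 <= V y by exact: le_trans xV.
  by rewrite primitive_at00 (min_l V0) (max_r V0) x0.
apply: continuous_in_subspaceT => t; rewrite inE/= in_itv/= => /andP[t0 ty].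
apply: primitive_at0_continuous; [lra|exact: D_down _ _ Dy ty].
Qed.

(** [U] stands for [F_pq] or [G_pq] and [A] for its domain. Agreement with [V] is asked on [A] only:
    at [y < 0] an integral over the empty [[0, y]] is 0, whereas [V] is negative on []-1, 0[]. *)
Variables (A : set R) (U : R -> R).
Hypothesis AE : forall y, A y <-> 0 <= y /\ D y.
Hypothesis UE : forall y, A y -> U y = V y.
Local Notation S := ('pinv_(fun=> 0) A U).

Lemma pinv_primitiveK y : A y -> S (U y) = y.
Proof.
move=> Ay; apply: pinvKV; rewrite ?inE//.
move=> a b /[!inE] Aa Ab; rewrite !UE//.
have [a0 Da] := (AE _).1 Aa; have [b0 Db] := (AE _).1 Ab.
apply: primitive_at0_inj => //; lra.
Qed.

(* Extending [v] to the left of 0 makes [V] differentiable with a differentiable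
   local inverse [g] at 0 too, so that the one-sided derivative at 0 is that of [g]. *)
Lemma derive1_from0_pinv_primitive y : A y -> derive1_from0 S (U y) = (v y)^-1.
Proof.
move=> Ay; have [y0 Dy] := (AE _).1 Ay.
have [z yz Dz] := D_open _ Dy.
have y1 : -1 < y by lra.
have vy0 : v y != 0 by rewrite gt_eqF// v_gt0.
pose g := 'pinv_(fun=> 0) `]-1, z[%classic V.
have gK : {in `]-1, z[, cancel V g}.
  move=> a az; apply: pinvKV; last by rewrite inE.
  move=> b c; rewrite !inE/= !in_itv/= => /andP[b1 bz] /andP[c1 cz].
  by apply: primitive_at0_inj => //; exact: D_down _ _ Dz (ltW _).
have near_y : \forall t \near y, t \in `]-1, z[.
  by apply: near_in_itvoo; rewrite in_itv/= y1.
have dg : is_derive (V y) 1 g (v y)^-1.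
  apply: is_derive_inverse => //.
  - by near=> t; apply: gK; near: t.
  - near=> t; have : t \in `]-1, z[ by near: t.
    rewrite in_itv/= => /andP[t1 tz]; apply: primitive_at0_continuous => //.
    exact: D_down _ _ Dz (ltW tz).
  - exact: is_derive_primitive_at0.
(* By the intermediate value theorem [t = V w] with [w] in [[0, z[], and both inverses return [w].
   The value [V z] is excluded because [z] is outside the interval on which [g] inverts [V]. *)
have Sg t : 0 <= t < V z -> S t = g t.
  move=> /andP[t0 tz]; have [] := @primitive_at0_IVT z t; [lra|by []|by rewrite t0 ltW|].
  move=> w; rewrite in_itv/= => /andP[w0 wz] Vwt.
  have {}wz : w < z.
    rewrite lt_neqAle wz andbT; apply/eqP => wzE.
    by rewrite -Vwt wzE ltxx in tz.
  have Aw : A w by apply/AE; split => //; exact: D_down _ _ Dz (ltW wz).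
  rewrite -[in LHS]Vwt -UE// pinv_primitiveK// -Vwt gK// in_itv/= wz andbT; lra.
have VyVz : V y < V z by exact: primitive_at0_lt.
rewrite /derive1_from0 UE//; case: eqP => [Vy0|/eqP Vy0].
- apply/cvg_lim; first exact: Rhausdorff.
  rewrite Vy0 in dg VyVz.
  have [dg1 dg2] := dg.
  have /cvg_ex[l gl] := dg1.
  have lE : l = (v y)^-1.
    by rewrite -dg2; apply/esym/cvg_lim => //; exact: Rhausdorff.
  rewrite -lE.
  (* The two-sided difference quotient of [g] converges, hence so does its restriction to the right
     of 0, where [S] and [g] agree. *)
  apply: (@cvg_trans _
    ((h^-1 *: (g (h *: (1 : R) + 0) - g 0)) @[h --> 0^'+])); last first.
    apply: cvg_trans gl; apply: cvg_fmap2.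
    by apply: within_subset => t /=; exact: lt0r_neq0.
  apply: near_eq_cvg; near=> h.
  have h0 : 0 < h by near: h; exact: nbhs_right_gt.
  rewrite /= [h *: _]mulr1 addr0 !Sg ?lexx ?(ltW h0)//=.
- have Vy : 0 < V y.
    rewrite -primitive_at00 primitive_at0_lt// lt_neqAle y0 andbT.
    by apply: contraNneq Vy0 => <-; rewrite primitive_at00.
  rewrite derive1E; have [_ <-] := dg; apply: near_eq_derive.
  near=> t; apply: Sg; apply/andP; split.
  + by apply: ltW; near: t; exact: lt_nbhsr.
  + by near: t; exact: lt_nbhsl.
Unshelve. all: end_near.
Qed.
End primitive.

(** * Continuity of real powers *)

Section powR_facts.
Local Open Scope classical_set_scope.
Local Open Scope ring_scope.
Context {R : realType}.
Implicit Types a q t : R.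

Lemma powR_continuous_gt0 a t : 0 < t -> {for t, continuous (fun s => s `^ a)}.
Proof.
move=> t0; apply/differentiable_continuous/derivable1_diffP.
exact: (@ex_derive _ _ _ _ _ _ _ (is_derive1_powR a t0)).
Qed.

(** Only 0 is delicate: the function is constant on its left, and the limit from the right is 0
    because [q] is positive. *)
Lemma powR_pos_part_continuous q : 0 < q ->
  continuous (fun t => Num.max 0 t `^ q).
Proof.
move=> q0 t; have [t0|t0|->] := ltgtP t 0.
- apply: (@near_cst_continuous _ _ 0).
  near=> s; rewrite max_l ?powR0 ?gt_eqF//.
  by apply/ltW; near: s; exact: lt_nbhsl.
- have /= := powR_continuous_gt0 q _ t0; rewrite /prop_for /continuous_at max_r ?ltW//.
  apply: cvg_trans; apply: near_eq_cvg; near=> s.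
  rewrite max_r//; apply: ltW; near: s; exact: lt_nbhsr.
- apply/left_right_continuousP; rewrite /= !maxxx powR0 ?gt_eqF//; split.
  + apply: cvg_near_cst; near=> s; rewrite max_l ?powR0 ?gt_eqF//.
  + apply: cvg_trans (powR_cvg0 q0); apply: near_eq_cvg; near=> s.
    by rewrite max_r//; near: s; exact: nbhs_right_ge.
Unshelve. all: by end_near. Qed.
End powR_facts.

(** * The two integrands, extended to the left of 0 *)

Section integrands.
Local Open Scope classical_set_scope.
Local Open Scope ring_scope.
Context {R : realType}.
Implicit Types p q r s t y : R.

(* [t `^ q = 1] for [t < 0]: the [max] is what makes the integrands continuous at 0. *)
Definition sin_integrand p q t := ((1 - Num.max 0 t `^ q) `^ p^-1)^-1.
Definition sinh_integrand r q t := ((1 + Num.max 0 t `^ q) `^ r^-1)^-1.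

Lemma subr_powR_gt0 q t : 0 < q -> t < 1 -> 0 < 1 - Num.max 0 t `^ q.
Proof.
move=> q0 t1; rewrite subr_gt0; have <- : 1 `^ q = 1 :> R by rewrite powR1.
by rewrite gt0_ltr_powR ?nnegrE ?le_max ?lexx// gt_max ltr01.
Qed.

Lemma addr_powR_ge1 q t : 1 <= 1 + t `^ q.
Proof. by rewrite lerDl powR_ge0. Qed.

Lemma addr_powR_gt0 q t : 0 < 1 + t `^ q.
Proof. exact: lt_le_trans (addr_powR_ge1 q t). Qed.

Lemma sin_integrand_gt0 p q t : 0 < q -> t < 1 -> 0 < sin_integrand p q t.
Proof. by move=> q0 t1; rewrite invr_gt0 powR_gt0// subr_powR_gt0. Qed.

Lemma sinh_integrand_gt0 r q t : 0 < sinh_integrand r q t.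
Proof. by rewrite invr_gt0 powR_gt0// addr_powR_gt0. Qed.

Lemma sin_integrand_continuous p q t : 0 < q -> t < 1 ->
  {for t, continuous (sin_integrand p q)}.
Proof.
move=> q0 t1; apply: cvgV; first by rewrite gt_eqF// powR_gt0// subr_powR_gt0.
apply: (@continuous_comp _ _ _ (fun t => 1 - Num.max 0 t `^ q) (fun s => s `^ p^-1)).
  by apply: cvgB; [exact: cvg_cst|exact: powR_pos_part_continuous].
by apply: powR_continuous_gt0; exact: subr_powR_gt0.
Qed.

Lemma sinh_integrand_continuous r q t : 0 < q ->
  {for t, continuous (sinh_integrand r q)}.
Proof.
move=> q0; apply: cvgV; first by rewrite gt_eqF// powR_gt0// addr_powR_gt0.
apply: (@continuous_comp _ _ _ (fun t => 1 + Num.max 0 t `^ q) (fun s => s `^ r^-1)).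
  by apply: cvgD; [exact: cvg_cst|exact: powR_pos_part_continuous].
by apply: powR_continuous_gt0; exact: addr_powR_gt0.
Qed.

Lemma F_pqE p q y : 0 < q -> 0 <= y < 1 ->
  F_pq p q y = primitive_at0 (sin_integrand p q) y.
Proof.
move=> q0 /andP[y0 y1].
have D_down (a b : R) : a < 1 -> b <= a -> b < 1.
  by move=> a1 ba; exact: le_lt_trans a1.
have fc a : a < 1 -> {for a, continuous (sin_integrand p q)}.
  exact: sin_integrand_continuous.
rewrite -(@primitive_at0E _ (sin_integrand p q) [set t | t < 1] D_down fc y y0 y1).
apply: eq_Rintegral => t; rewrite inE/= in_itv/= => /andP[t0 _].
by rewrite /sin_integrand max_r.
Qed.

Lemma G_pqE r q y : 0 < q -> 0 <= y ->
  G_pq r q y = primitive_at0 (sinh_integrand r q) y.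
Proof.
move=> q0 y0.
have gc a : [set: R] a -> {for a, continuous (sinh_integrand r q)}.
  by move=> _; exact: sinh_integrand_continuous.
rewrite -(@primitive_at0E _ (sinh_integrand r q) setT (fun _ _ _ _ => I) gc y y0 I).
apply: eq_Rintegral => t; rewrite inE/= in_itv/= => /andP[t0 _].
by rewrite /sinh_integrand max_r.
Qed.
End integrands.

(** * The change of variables from the hyperbolic to the circular integral *)

Section substitution.
Local Open Scope classical_set_scope.
Local Open Scope ring_scope.
Context {R : realType}.
Implicit Types p q r s t x y : R.

(** The cut-off by [max] again serves continuity at 0, an endpoint of the segment to which the mean
    value theorem is applied. *)
Definition sinh_to_sin q s := s * (1 + Num.max 0 s `^ q) `^ (- q^-1).

Lemma sinh_to_sin_ge0 q s : 0 <= s -> 0 <= sinh_to_sin q s.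
Proof. by move=> s0; rewrite mulr_ge0// powR_ge0. Qed.

(** The q-th power of the image of s is s^q / (1 + s^q). This plays the part of the Pythagorean
    identity: it converts one integrand into a power of 1 + s^q and keeps the image below 1. *)
Lemma sinh_to_sin_powR q s : 0 < q -> 0 <= s ->
  1 - sinh_to_sin q s `^ q = (1 + s `^ q)^-1.
Proof.
move=> q0 s0; rewrite /sinh_to_sin max_r// powRM ?powR_ge0// -powRrM.
rewrite mulNr mulVf ?gt_eqF// powR_inv1 ?(ltW (addr_powR_gt0 _ _))//.
have := addr_powR_gt0 q s; move: (s `^ q) => w w0; field.
by rewrite gt_eqF.
Qed.

Lemma sinh_to_sin_lt1 q s : 0 < q -> 0 <= s -> sinh_to_sin q s < 1.
Proof.
move=> q0 s0; rewrite ltNge; apply/negP => le1.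
have : 0 < 1 - sinh_to_sin q s `^ q.
  by rewrite sinh_to_sin_powR// invr_gt0 addr_powR_gt0.
have : 1 `^ q <= sinh_to_sin q s `^ q.
  by rewrite ge0_ler_powR ?nnegrE ?sinh_to_sin_ge0// ltW.
by rewrite powR1 subr_gt0 => /le_lt_trans/[apply]; rewrite ltxx.
Qed.

Lemma sin_integrand_sinh_to_sin p q s : 0 < q -> 0 <= s ->
  sin_integrand p q (sinh_to_sin q s) = (1 + s `^ q) `^ p^-1.
Proof.
move=> q0 s0; rewrite /sin_integrand max_r ?sinh_to_sin_ge0//.
rewrite sinh_to_sin_powR// -[in LHS](powR_inv1 (ltW (addr_powR_gt0 q s))).
by rewrite -powRrM mulN1r powRN invrK.
Qed.

Lemma sinh_to_sin_surj q y : 0 < q -> 0 <= y < 1 ->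
  exists2 s, 0 <= s & sinh_to_sin q s = y.
Proof.
move=> q0 /andP[y0 y1].
have c0 : 0 < 1 - y `^ q by have := subr_powR_gt0 _ _ q0 y1; rewrite max_r.
(* The witness comes from solving y^q = s^q / (1 + s^q), that is s^q = y^q / (1 - y^q). *)
exists (y * (1 - y `^ q) `^ (- q^-1)); first by rewrite mulr_ge0// powR_ge0.
rewrite /sinh_to_sin max_r ?mulr_ge0 ?powR_ge0// powRM ?powR_ge0//.
rewrite -powRrM mulNr mulVf ?gt_eqF// powR_inv1 ?(ltW c0)//.
have -> : 1 + y `^ q * (1 - y `^ q)^-1 = (1 - y `^ q)^-1.
  by move: (y `^ q) c0 => w w0; field; rewrite gt_eqF.
rewrite -(powR_inv1 (ltW c0)) -powRrM mulrNN mul1r -mulrA -powRD.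
  by rewrite addNr powRr0 mulr1.
by apply/implyP => _; rewrite gt_eqF.
Qed.

(** The product rule gives (1 + s^q)^(-1/q) - s^q (1 + s^q)^(-1/q - 1); once the common power is
    factored out, (1 + s^q) - s^q = 1 remains. *)
Lemma is_derive_sinh_to_sin q s : 0 < q -> 0 < s ->
  is_derive s 1 (sinh_to_sin q) ((1 + s `^ q) `^ (- q^-1 - 1)).
Proof.
move=> q0 s0; have w0 := addr_powR_gt0 q s.
apply: (@near_eq_is_derive _ _ _ (fun t => t * (1 + t `^ q) `^ (- q^-1))).
  by near=> t; rewrite /sinh_to_sin max_r//; apply: ltW; near: t; exact: lt_nbhsr.
have ds : is_derive s 1 (fun t => t `^ q) (q * s `^ (q - 1)) by exact: is_derive1_powR.
have dw : is_derive s 1 (fun t => 1 + t `^ q) (q * s `^ (q - 1)).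
  by rewrite -[X in is_derive _ _ _ X]add0r; apply: is_deriveD.
have dp := @is_derive1_powR _ (- q^-1) _ w0.
have dc := @is_derive1_comp _ (fun w => w `^ (- q^-1)) (fun t => 1 + t `^ q) s _ _ dp dw.
have dm := @is_deriveM _ _ id _ s 1 _ _ (is_derive_id s 1) dc.
apply: (is_derive_eq dm); rewrite /= /GRing.scale/=.
have -> : (1 + s `^ q) `^ (- q^-1) = (1 + s `^ q) `^ (- q^-1 - 1) * (1 + s `^ q).
  rewrite -[X in _ * X]powRr1 ?(ltW w0)// -powRD ?subrK//.
  by apply/implyP => _; rewrite gt_eqF.
have := mulr_powRB1 (ltW s0) q0.
move: ((1 + s `^ q) `^ (- q^-1 - 1)) (s `^ (q - 1)) (s `^ q) => a b c sb.
rewrite -sb; field; by rewrite gt_eqF.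
Unshelve. all: by end_near. Qed.

Lemma sinh_to_sin_continuous q : 0 < q -> continuous (sinh_to_sin q).
Proof.
move=> q0 s; apply: cvgM; first exact: cvg_id.
apply: (@continuous_comp _ _ _ (fun t => 1 + Num.max 0 t `^ q) (fun s => s `^ (- q^-1))).
  by apply: cvgD; [exact: cvg_cst|exact: powR_pos_part_continuous].
by apply: powR_continuous_gt0; exact: addr_powR_gt0.
Qed.

(** The difference of the two sides vanishes at 0 and has zero derivative on []0, s[], so the mean
    value theorem replaces a change of variables under the integral. *)
Lemma F_pq_sinh_to_sin p q r s : 0 < q -> p^-1 + r^-1 = 1 + q^-1 -> 0 <= s ->
  F_pq p q (sinh_to_sin q s) = G_pq r q s.
Proof.
move=> q0 pqr s0; have phi01 : 0 <= sinh_to_sin q s < 1.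
  by rewrite sinh_to_sin_ge0 ?sinh_to_sin_lt1.
rewrite (F_pqE p _ _ q0 phi01) (G_pqE r _ _ q0 s0).
pose f := primitive_at0 (sin_integrand p q); pose g := primitive_at0 (sinh_integrand r q).
rewrite -/f -/g.
have f' y : -1 < y -> y < 1 -> is_derive y 1 f (sin_integrand p q y).
  move=> y0 y1; apply: (@is_derive_primitive_at0 _ _ [set t | t < 1]) => //=.
  - by move=> a b /= a1 ba; exact: le_lt_trans a1.
  - by move=> a /= a1; exists ((a + 1) / 2); lra.
  - by move=> a /= a1; exact: sin_integrand_continuous.
have g' y : -1 < y -> is_derive y 1 g (sinh_integrand r q y).
  move=> y0; apply: (@is_derive_primitive_at0 _ _ setT) => //=.
  - by move=> a _; exists (a + 1) => //; rewrite ltrDl.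
  - by move=> a _; exact: sinh_integrand_continuous.
have f0 : f 0 = 0 by exact: primitive_at00.
have g0 : g 0 = 0 by exact: primitive_at00.
clearbody f g; pose h t := f (sinh_to_sin q t) - g t.
have phi1 t : 0 <= t -> -1 < sinh_to_sin q t.
  by move=> t0; rewrite (lt_le_trans _ (sinh_to_sin_ge0 q _ t0))// ltrN10.
have h' t : t \in `]0, s[ -> is_derive t 1 h 0.
  rewrite in_itv/= => /andP[t0 _].
  have df := f' _ (phi1 _ (ltW t0)) (sinh_to_sin_lt1 _ _ q0 (ltW t0)).
  have dphi := is_derive_sinh_to_sin _ _ q0 t0.
  have dfphi := is_derive1_comp df dphi.
  have dg := g' t (lt_trans (ltrN10 _) t0).
  have dh := is_deriveB dfphi dg.
  apply: (is_derive_eq dh).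
  rewrite sin_integrand_sinh_to_sin ?(ltW t0)// -powRD; last first.
    by apply/implyP => _; rewrite gt_eqF// addr_powR_gt0.
  rewrite /sinh_integrand max_r ?(ltW t0)// -powRN.
  (* The relation between [p], [q] and [r] is exactly what makes the two derivatives cancel. *)
  have -> : p^-1 + (- q^-1 - 1) = - r^-1.
    by rewrite -[r^-1](addKr p^-1) pqr; ring.
  by rewrite subrr.
have hc : {within `[0, s], continuous h}.
  apply: continuous_in_subspaceT => t; rewrite inE/= in_itv/= => /andP[t0 _].
  have cf : {for sinh_to_sin q t, continuous f}.
    apply/differentiable_continuous/derivable1_diffP.
    by have [] := f' _ (phi1 _ t0) (sinh_to_sin_lt1 _ _ q0 t0).
  have cg : {for t, continuous g}.
    apply/differentiable_continuous/derivable1_diffP.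
    by have [] := g' t (lt_le_trans (ltrN10 _) t0).
  have cfphi : {for t, continuous (f \o sinh_to_sin q)}.
    by apply: continuous_comp; [exact: sinh_to_sin_continuous|exact: cf].
  exact: (cvgB cfphi cg).
have [c _] := MVT_segment s0 h' hc.
rewrite mul0r /h /sinh_to_sin mul0r f0 g0 !subr0.
by move=> /eqP; rewrite subr_eq0 => /eqP.
Qed.

(** If [F_pq] stayed below [x] on [[0, 1[], monotone convergence would bound the integral over [[0,
    1[] by [x], against the hypothesis, whether that integral is finite or not. So some value
    reaches [x], and the intermediate value theorem concludes. *)
Lemma F_pq_surj p q x : 0 < q -> 0 <= x -> (x%:E < pi_pq p q / 2%:E)%E ->
  exists2 y, 0 <= y < 1 & F_pq p q y = x.
Proof.
move=> q0 x0 xpi; pose f := sin_integrand p q.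
have D_down (a b : R) : a < 1 -> b <= a -> b < 1.
  by move=> a1 ba; exact: le_lt_trans a1.
have D_open (a : R) : a < 1 -> exists2 z, a < z & z < 1.
  by move=> a1; exists ((a + 1) / 2); lra.
have fc y : y < 1 -> {for y, continuous f} by exact: sin_integrand_continuous.
have [y [y0 y1 xFy]] : exists y, [/\ 0 <= y, y < 1 & x <= F_pq p q y].
  apply: contrapT => noy; move: xpi; apply/negP; rewrite -leNgt.
  have F_lt y : 0 <= y -> y < 1 -> F_pq p q y < x.
    by move=> y0 y1; rewrite ltNge; apply/negP => xF; apply: noy; exists y.
  (* The factor 2 of [pi_pq] cancels, leaving a bound on the integral over [[0, 1[], which is then
     exhausted by the segments [I n]. *)
  rewrite inver pnatr_eq0/= lee_pdivrMr// [leRHS]muleC lee_pmul2l//.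
  pose I n : set R := `[0, 1 - n.+1%:R^-1]%classic.
  have I1 n : 1 - n.+1%:R^-1 < 1 :> R by rewrite ltrBlDr ltrDl invr_gt0 ltr0n.
  have I0 n : 0 <= 1 - n.+1%:R^-1 :> R by rewrite subr_ge0 invf_le1// ler1n.
  have fI n : lebesgue_measure.-integrable (I n)
      (fun t => (((1 - t `^ q) `^ p^-1)^-1)%:E).
    have fI := @integrable_segment _ f [set t | t < 1] D_down fc 0 _ (I1 n).
    refine (@eq_integrable _ _ _ (@lebesgue_measure R) (I n) (measurable_itv _)
      (EFin \o f) _ _ fI) => t.
    rewrite inE /I/= in_itv/= => /andP[t0 _].
    by rewrite /f /sin_integrand max_r.
  rewrite itv_bnd_open_bigcup.
  have Icvg : (\int[lebesgue_measure]_(t in I n) (((1 - t `^ q) `^ p^-1)^-1)%:E)%E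
      @[n --> \oo] --> (\int[lebesgue_measure]_(t in \bigcup_n I n)
                         (((1 - t `^ q) `^ p^-1)^-1)%:E)%E.
    apply: ge0_nondecreasing_set_cvg_integral.
    - apply/nondecreasing_seqP => n; rewrite subsetEset; apply: subset_itvl.
      rewrite bnd_simp lerD2l lerN2 lef_pV2 ?posrE ?ltr0n//.
      by rewrite ler_nat.
    - by move=> n; exact: measurable_itv.
    - by move=> n; exact: measurable_int (fI n).
    - by move=> n t _; rewrite lee_fin invr_ge0 powR_ge0.
  rewrite -(cvg_lim _ Icvg)//.
  apply: lime_le; first by apply/cvg_ex; eexists; exact: Icvg.
  (* [F_pq] is a real-valued integral, so the extended one must be known finite before the two can
     be compared. *)
  near=> n; rewrite -[leLHS]fineK; last first.
    by apply: integrable_fin_num; [exact: measurable_itv|exact: fI].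
  by rewrite lee_fin; apply/ltW/F_lt.
have := @primitive_at0_IVT _ f [set t | t < 1] D_down D_open fc y x y0 y1.
rewrite -F_pqE ?y0// x0 xFy => /(_ isT)[w]; rewrite in_itv/= => /andP[w0 wy] fw.
have w1 : w < 1 by exact: le_lt_trans y1.
by exists w; rewrite ?F_pqE ?w0.
Unshelve. all: by end_near. Qed.
End substitution.

(** * Values of the generalized functions at points given by the integrals *)

Section inverses.
Context {R : realType}.
Implicit Types p q r s y : R.

Lemma sin_cos_F_pq p q y : 0 < q -> 0 <= y < 1 ->
  sin_pq p q (F_pq p q y) = y /\
  cos_pq p q (F_pq p q y) = (sin_integrand p q y)^-1.
Proof.
move=> q0 y01; pose D : set R := [set t | t < 1]%classic.
have D_down a b : D a -> b <= a -> D b by move=> a1 ba; exact: le_lt_trans a1.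
have D_open a : D a -> exists2 z, a < z & D z.
  by rewrite /D/= => a1; exists ((a + 1) / 2); lra.
have vc a : D a -> {for a, continuous (sin_integrand p q)}.
  exact: sin_integrand_continuous.
have v0 a : D a -> 0 < sin_integrand p q a by exact: sin_integrand_gt0.
have AE a : `[0, 1[%classic a <-> 0 <= a /\ D a.
  by rewrite /D/= in_itv/=; split => /andP.
have UE a : `[0, 1[%classic a -> F_pq p q a = primitive_at0 (sin_integrand p q) a.
  by rewrite /= in_itv/=; exact: F_pqE.
have Ay : `[0, 1[%classic y by rewrite /= in_itv.
split.
  exact: (pinv_primitiveK _ D D_down D_open vc v0 _ _ AE UE).
exact: (derive1_from0_pinv_primitive _ D D_down D_open vc v0 _ _ AE UE).
Qed.

Lemma sinh_cosh_G_pq r q s : 0 < q -> 0 <= s ->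
  sinh_pq r q (G_pq r q s) = s /\
  cosh_pq r q (G_pq r q s) = (sinh_integrand r q s)^-1.
Proof.
move=> q0 s0; pose D : set R := setT.
have D_down a b : D a -> b <= a -> D b by [].
have D_open a : D a -> exists2 z, a < z & D z.
  by move=> _; exists (a + 1); rewrite // ltrDl.
have vc a : D a -> {for a, continuous (sinh_integrand r q)}.
  by move=> _; exact: sinh_integrand_continuous.
have v0 a : D a -> 0 < sinh_integrand r q a.
  by move=> _; exact: sinh_integrand_gt0.
have AE a : `[0, +oo[%classic a <-> 0 <= a /\ D a.
  by rewrite /= in_itv/= andbT; split=> [|[]].
have UE a : `[0, +oo[%classic a -> G_pq r q a = primitive_at0 (sinh_integrand r q) a.
  by rewrite /= in_itv/= andbT; exact: G_pqE.
have As : `[0, +oo[%classic s by rewrite /= in_itv/= s0.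
split.
  exact: (pinv_primitiveK _ D D_down D_open vc v0 _ _ AE UE).
exact: (derive1_from0_pinv_primitive _ D D_down D_open vc v0 _ _ AE UE).
Qed.
End inverses.

Theorem lemma1p2 (R : realType) (p q r : R)
  (hq : 1 < q) (hp : q / (q + 1) < p) (hr : p^-1 + r^-1 = 1 + q^-1)
  (x : R) (hx0 : 0 <= x) (hx : (x%:E < pi_pq p q / 2%:E)%E) :
  sin_pq p q x = sinh_pq r q x / (cosh_pq r q x `^ (r / q)) /\
  cos_pq p q x = 1 / (cosh_pq r q x `^ (r / p)).
Proof.
have q0 : 0 < q by lra.
have p0 : 0 < p by apply: lt_trans hp; rewrite divr_gt0//; lra.
(* With the convention [0^-1 = 0], [r = 0] would satisfy [hr] precisely when p = q / (q + 1), which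
   the strict bound [hp] excludes. *)
have r0 : r != 0.
  apply: contraTneq hp => r0; rewrite -leNgt -[p]invrK.
  have -> : p^-1 = (q + 1) / q.
    by rewrite -[p^-1]addr0 -[X in _ + X]invr0 -r0 hr; field; rewrite gt_eqF.
  by rewrite invf_div.
have [y y01 Fyx] := F_pq_surj _ _ _ q0 hx0 hx.
have [s s0 sy] := sinh_to_sin_surj _ _ q0 y01.
have [sinE cosE] := sin_cos_F_pq p _ _ q0 y01.
have [sinhE coshE] := sinh_cosh_G_pq r _ _ q0 s0.
have Gsx : G_pq r q s = x by rewrite -(F_pq_sinh_to_sin _ _ _ _ q0 hr s0) sy.
rewrite Fyx -sy in sinE cosE; rewrite Gsx in sinhE coshE.
rewrite sinE cosE sinhE coshE /sinh_integrand invrK sin_integrand_sinh_to_sin//.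
(* The exponents r/q and r/p meet the 1/r of the hyperbolic cosine, and [r] cancels. *)
by rewrite /sinh_to_sin (max_r s0) -!powRrM !mulrA (mulVf r0) !mul1r powRN.
Qed.
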